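(* Let $n\ge 2$. (a) The assignment $\sigma_i^{\pm1}\mapsto\sigma_i^{\pm1}$, $\tau_i\mapsto p_i=\sigma_i^2$ ($1\le i\le n-1$) defines a homomorphism of monoids $s\Phi\colon SB_n\to B_n$ from the singular braid monoid to the braid group, which is surjective but not injective. (b) The restriction of this assignment to the elementary braidings and the first singular crossing, $\sigma_i^{\pm1}\mapsto\sigma_i^{\pm1}$, $\tau_1\mapsto p_1=\sigma_1^2$ (with $SB_n$ in its presentation with the single singular generator $\tau_1$), defines a surjective but not injective homomorphism of monoids $SB_n\to B_n$. (c) For every integer $p\in\mathbb Z$, the assignment $\sigma_i^{\pm1}\mapsto\sigma_i^{\pm1}$, $\tau_i\mapsto\sigma_i^{2p}$ defines a non-injective epimorphism of monoids $s\Phi_p\colon SB_n\to B_n$, which can likewise be restricted to only the first singular crossing $\tau_1$ (i.e. it is defined by $\sigma_i^{\pm1}\mapsto\sigma_i^{\pm1}$, $\tau_1\mapsto\sigma_1^{2p}$ in the presentation of $SB_n$ with the single singular generator $\tau_1$).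
   Context: $B_n$ is the Artin braid group with generators $\sigma_1,\dots,\sigma_{n-1}$ and relations $\sigma_i\sigma_j=\sigma_j\sigma_i$ for $|i-j|>1$ and $\sigma_i\sigma_{i+1}\sigma_i=\sigma_{i+1}\sigma_i\sigma_{i+1}$ for $1\le i\le n-2$. The singular braid monoid $SB_n$ is the monoid generated by $\sigma_i^{\pm1}$ and $\tau_i$, $1\le i\le n-1$, with relations $\sigma_i\sigma_i^{-1}=\sigma_i^{-1}\sigma_i=1$ and: 1) $\sigma_i\sigma_j=\sigma_j\sigma_i$ for $|i-j|>1$; 2) $\sigma_i\sigma_{i+1}\sigma_i=\sigma_{i+1}\sigma_i\sigma_{i+1}$ for all $i$; 3) $\tau_i\tau_j=\tau_j\tau_i$ for $|i-j|>1$; 4) $\tau_i\sigma_j=\sigma_j\tau_i$ for $|i-j|>1$; 5) $\tau_i\sigma_i=\sigma_i\tau_i$ for all $i$; 6) $\tau_i\sigma_{i+1}\sigma_i=\sigma_{i+1}\sigma_i\tau_{i+1}$ for all $i$; 7) $\sigma_i\sigma_{i+1}\tau_i=\tau_{i+1}\sigma_i\sigma_{i+1}$ for all $i$. $SB_n$ also has a presentation with generators $\sigma_1^{\pm1},\dots,\sigma_{n-1}^{\pm1}$ and the single singular generator $\tau_1$, with relations $\sigma_i\sigma_i^{-1}=\sigma_i^{-1}\sigma_i=1$, relations 1) and 2) above, and (omitting relations that mention $\sigma_k$ with $k\ge n$): $\tau_1(\sigma_2\sigma_1\sigma_3\sigma_2)^{-1}\tau_1(\sigma_2\sigma_1\sigma_3\sigma_2)=(\sigma_2\sigma_1\sigma_3\sigma_2)^{-1}\tau_1(\sigma_2\sigma_1\sigma_3\sigma_2)\tau_1$;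 $\tau_1\sigma_j=\sigma_j\tau_1$ for $j>2$; $\tau_1\sigma_1=\sigma_1\tau_1$; $\tau_1(\sigma_2\sigma_1)(\sigma_1\sigma_2)=(\sigma_2\sigma_1)(\sigma_1\sigma_2)\tau_1$. *)

(* Defs.v *)
From HB Require Import structures.
From mathcomp Require Import all_boot ssralg ssrint.
From mathcomp Require Import zify boolp.

Set Implicit Arguments.
Unset Strict Implicit.
Unset Printing Implicit Defensive.

Local Open Scope group_scope.

(* presented R is the free monoid [seq X] modulo the congruence generated by  *)
(* R; when X contains formal inverses and R cancels them, it is a group.      *)

Inductive congruence (X : Type) (R : seq X -> seq X -> Prop) :
    seq X -> seq X -> Prop :=
  | Cong_rel u v of R u v : congruence R u v
  | Cong_refl u : congruence R u u
  | Cong_sym u v of congruence R u v : congruence R v u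
  | Cong_trans v u w of congruence R u v & congruence R v w : congruence R u w
  | Cong_cat u u' v v' of congruence R u u' & congruence R v v' :
      congruence R (u ++ v) (u' ++ v').

Section Presented.
Variables (X : choiceType) (R : seq X -> seq X -> Prop).

Definition congruenceb : rel (seq X) := fun u v => `[< congruence R u v >].

Lemma congruenceb_refl : reflexive congruenceb.
Proof. by move=> u; apply/asboolP; apply: Cong_refl. Qed.

Lemma congruenceb_sym : symmetric congruenceb.
Proof. by move=> u v; apply/asboolP/asboolP; apply: Cong_sym. Qed.

Lemma congruenceb_trans : transitive congruenceb.
Proof.
by move=> v u w /asboolP uv /asboolP vw; apply/asboolP; apply: Cong_trans vw.
Qed.

Canonical congruenceb_equiv :=
  EquivRel congruenceb congruenceb_refl congruenceb_sym congruenceb_trans.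

Definition presented : Type := {eq_quot congruenceb}%qT.

HB.instance Definition _ := Choice.on presented.
HB.instance Definition _ := Quotient.on presented.
HB.instance Definition _ := EqQuotient.on presented.

Definition pword (u : seq X) : presented := \pi_presented%qT u.
Definition pgen (x : X) : presented := pword [:: x].

Lemma pwordP u v : pword u = pword v <-> congruence R u v.
Proof. by split=> [/eqmodP/asboolP | uv]; last by apply/eqmodP/asboolP. Qed.

Lemma pword_surj (a : presented) : exists u, a = pword u.
Proof. by exists (repr a); rewrite /pword reprK. Qed.

(* Locked, so that a product is never unified with [pword] of a word. *)
Fact presented_mul_key : unit. Proof. exact: tt. Qed.
Definition presented_mul : presented -> presented -> presented :=
  locked_with presented_mul_key (fun a b => pword (repr a ++ repr b)).

Lemma pword_cat u v : pword (u ++ v) = presented_mul (pword u) (pword v).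
Proof.
rewrite /presented_mul unlock.
by apply/pwordP/Cong_cat; apply/pwordP; rewrite /pword reprK.
Qed.

Lemma presented_mulA : associative presented_mul.
Proof.
move=> a b c; case: (pword_surj a) (pword_surj b) (pword_surj c).
by move=> u -> [v ->] [w ->]; rewrite -!pword_cat catA.
Qed.

Lemma presented_mul1 : left_id (pword [::]) presented_mul.
Proof. by move=> a; have [u ->] := pword_surj a; rewrite -pword_cat. Qed.

Lemma presented_1mul : right_id (pword [::]) presented_mul.
Proof. by move=> a; have [u ->] := pword_surj a; rewrite -pword_cat cats0. Qed.

HB.instance Definition _ := isMonoid.Build presented
  presented_mulA presented_mul1 presented_1mul.

Lemma pwordM u v : pword (u ++ v) = pword u * pword v.
Proof. exact: pword_cat. Qed.

Lemma pword0 : pword [::] = 1.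
Proof. by []. Qed.

Lemma pword_prod u : pword u = \prod_(x <- u) pgen x.
Proof.
by elim: u => [|x u IHu]; rewrite ?big_nil // big_cons -IHu -pwordM.
Qed.

(* The assignment a on generators defines the homomorphism f: f is a          *)
(* homomorphism of monoids with the prescribed values, and the only one.      *)
Definition defines_morphism (M : monoidType) (a : X -> M)
    (f : presented -> M) : Prop :=
  [/\ monoid_morphism f,
      forall x, f (pgen x) = a x &
      forall g : presented -> M, monoid_morphism g ->
        (forall x, g (pgen x) = a x) -> g =1 f].

Lemma presented_lift (M : monoidType) (a : X -> M) :
  (forall u v, R u v -> \prod_(x <- u) a x = \prod_(x <- v) a x) ->
  exists f, defines_morphism a f.
Proof.
move=> Ra; pose ev u := \prod_(x <- u) a x.
have evP u v : congruence R u v -> ev u = ev v.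
  elim=> {u v} [u v /Ra//|//|//|v u w _ -> //|u u' v v' _ Eu _ Ev].
  by rewrite /ev !big_cat /= -/(ev u) -/(ev v) Eu Ev.
pose f (b : presented) := ev (repr b).
have fE u : f (pword u) = ev u by apply/evP/pwordP; rewrite /pword reprK.
exists f; split=> [|x|g [g1 gM] ga b].
- split=> [|b c]; first by rewrite -pword0 fE /ev big_nil.
  have [[u ->] [v ->]] := (pword_surj b, pword_surj c).
  by rewrite -pwordM !fE /ev big_cat.
- by rewrite fE /ev big_seq1.
have [u ->] := pword_surj b; rewrite fE pword_prod /ev.
by elim: u => [|x u IHu]; rewrite ?big_nil // !big_cons gM IHu ga.
Qed.

Lemma presented_morphism_eq (M : monoidType) (f g : presented -> M) :
  monoid_morphism f -> monoid_morphism g ->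
  (forall x, f (pgen x) = g (pgen x)) -> f =1 g.
Proof.
move=> [f1 fM] [g1 gM] fg b; have [u ->] := pword_surj b; rewrite pword_prod.
by elim: u => [|x u IHu]; rewrite ?big_nil ?f1 ?g1 // !big_cons fM gM IHu fg.
Qed.

End Presented.

Arguments pgen {X R} x.
Arguments pword {X R} u.
Arguments pwordP {X R u v}.

(* Indices are shifted by one: sigma_1, ..., sigma_(n-1) and tau_1, ...,      *)
(* tau_(n-1) are indexed by 'I_n.-1 = {0, ..., n-2}.                          *)

Definition far n (i j : 'I_n) : bool := (i.+1 < j) || (j.+1 < i).

Inductive braid_gen (n : nat) : Type :=
  | Sg of 'I_n.-1
  | SgV of 'I_n.-1.

HB.instance Definition _ n := gen_eqMixin (braid_gen n).
HB.instance Definition _ n := gen_choiceMixin (braid_gen n).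

Inductive braid_rel (n : nat) : seq (braid_gen n) -> seq (braid_gen n) -> Prop :=
  | Brel_mulV i : braid_rel [:: Sg i; SgV i] [::]
  | Brel_Vmul i : braid_rel [:: SgV i; Sg i] [::]
  | Brel_comm (i j : 'I_n.-1) of far i j : braid_rel [:: Sg i; Sg j] [:: Sg j; Sg i]
  | Brel_braid (i j : 'I_n.-1) of j = i.+1 :> nat :
      braid_rel [:: Sg i; Sg j; Sg i] [:: Sg j; Sg i; Sg j].

Definition braid (n : nat) : Type := presented (@braid_rel n).
HB.instance Definition _ n := Monoid.on (braid n).

Definition gen_inv n (x : braid_gen n) : braid_gen n :=
  match x with Sg i => SgV i | SgV i => Sg i end.

Definition word_inv n (u : seq (braid_gen n)) : seq (braid_gen n) :=
  rev (map (@gen_inv n) u).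

Section BraidGroup.
Variable n : nat.

Let gen_invK : involutive (@gen_inv n). Proof. by case. Qed.

Let word_invK : involutive (@word_inv n).
Proof. by move=> u; rewrite /word_inv map_rev revK mapK. Qed.

Lemma word_invM u : pword (word_inv u) * pword u = 1 :> braid n.
Proof.
elim: u => [|x u IHu]; first by rewrite mulg1.
have xV : pword [:: gen_inv x; x] = 1 :> braid n.
  by case: x => i; apply/(@pwordP _ _ _ [::])/Cong_rel; constructor.
rewrite /word_inv /= rev_cons -cats1 -/(word_inv u) -pwordM -catA.
by rewrite -[[:: _] ++ _]/([:: gen_inv x; x] ++ u) !pwordM xV mul1g.
Qed.

Lemma word_mulV u : pword u * pword (word_inv u) = 1 :> braid n.
Proof. by rewrite -{1}[u]word_invK word_invM. Qed.

Definition braid_inv (b : braid n) : braid n := pword (word_inv (repr b)).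

Lemma braid_mulV : left_inverse 1 braid_inv (@mul (braid n)).
Proof.
move=> b; rewrite /braid_inv -{2}[b]reprK; exact: word_invM.
Qed.

Lemma braid_mulgV : right_inverse 1 braid_inv (@mul (braid n)).
Proof.
move=> b; rewrite /braid_inv -{1}[b]reprK; exact: word_mulV.
Qed.

End BraidGroup.

HB.instance Definition _ n := hasInv.Build (braid n) (@braid_inv n).
HB.instance Definition _ n :=
  Monoid_isGroup.Build (braid n) (@braid_mulV n) (@braid_mulgV n).

Definition sigma n (i : 'I_n.-1) : braid n := pgen (Sg i).

Lemma sigmaV n (i : 'I_n.-1) : pgen (SgV i) = (sigma i)^-1 :> braid n.
Proof.
apply/esym/mulg1_eq; rewrite /sigma -pwordM.
by apply/(@pwordP _ _ _ [::])/Cong_rel; constructor.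
Qed.

Inductive sbraid_gen (n : nat) : Type :=
  | Br of braid_gen n
  | Tau of 'I_n.-1.

HB.instance Definition _ n := gen_eqMixin (sbraid_gen n).
HB.instance Definition _ n := gen_choiceMixin (sbraid_gen n).

Local Notation bs i := (Br (Sg i)).

Inductive sbraid_rel (n : nat) :
    seq (sbraid_gen n) -> seq (sbraid_gen n) -> Prop :=
  | SBrel_braid u v of braid_rel u v :
      sbraid_rel (map (@Br n) u) (map (@Br n) v)
  | SBrel_tautau (i j : 'I_n.-1) of far i j : sbraid_rel [:: Tau i; Tau j] [:: Tau j; Tau i]
  | SBrel_tausigma (i j : 'I_n.-1) of far i j : sbraid_rel [:: Tau i; bs j] [:: bs j; Tau i]
  | SBrel_comm i : sbraid_rel [:: Tau i; bs i] [:: bs i; Tau i]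
  | SBrel_left (i j : 'I_n.-1) of j = i.+1 :> nat :
      sbraid_rel [:: Tau i; bs j; bs i] [:: bs j; bs i; Tau j]
  | SBrel_right (i j : 'I_n.-1) of j = i.+1 :> nat :
      sbraid_rel [:: bs i; bs j; Tau i] [:: Tau j; bs i; bs j].

Definition sbraid (n : nat) : Type := presented (@sbraid_rel n).
HB.instance Definition _ n := Monoid.on (sbraid n).

(* The presentation with the single singular generator tau_1, for n >= 2.  A  *)
(* relation mentioning sigma_k is quantified over an index in 'I_n.-1 whose   *)
(* value is k-1, so it is present exactly when k < n.                         *)

Inductive sbraid1_gen (n : nat) : Type :=
  | Br1 of braid_gen n
  | Tau1.
Arguments Tau1 {n}.

HB.instance Definition _ n := gen_eqMixin (sbraid1_gen n).
HB.instance Definition _ n := gen_choiceMixin (sbraid1_gen n).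

Local Notation bs1 i := (Br1 (Sg i)).

Inductive sbraid1_rel (n : nat) :
    seq (sbraid1_gen n) -> seq (sbraid1_gen n) -> Prop :=
  | SB1rel_braid u v of braid_rel u v :
      sbraid1_rel (map (@Br1 n) u) (map (@Br1 n) v)
  | SB1rel_tautau (i j k : 'I_n.-1) (w := [:: Sg j; Sg i; Sg k; Sg j]) of
        i = 0%N :> nat & j = 1%N :> nat & k = 2%N :> nat :
      sbraid1_rel
        ([:: Tau1] ++ map (@Br1 n) (word_inv w) ++ [:: Tau1] ++ map (@Br1 n) w)
        (map (@Br1 n) (word_inv w) ++ [:: Tau1] ++ map (@Br1 n) w ++ [:: Tau1])
  | SB1rel_tausigma (j : 'I_n.-1) of 1 < j : sbraid1_rel [:: Tau1; bs1 j] [:: bs1 j; Tau1]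
  | SB1rel_comm (i : 'I_n.-1) of i = 0%N :> nat :
      sbraid1_rel [:: Tau1; bs1 i] [:: bs1 i; Tau1]
  | SB1rel_left (i j : 'I_n.-1) of i = 0%N :> nat & j = 1%N :> nat :
      sbraid1_rel [:: Tau1; bs1 j; bs1 i; bs1 i; bs1 j]
                  [:: bs1 j; bs1 i; bs1 i; bs1 j; Tau1].

Definition sbraid1 (n : nat) : Type := presented (@sbraid1_rel n).
HB.instance Definition _ n := Monoid.on (sbraid1 n).

Definition expgz (G : groupType) (x : G) (p : int) : G :=
  match p with Posz m => x ^+ m | Negz m => x ^- m.+1 end.

Definition assign n (t : 'I_n.-1 -> braid n) (x : sbraid_gen n) : braid n :=
  match x with Br b => pgen b | Tau i => t i end.

Definition assign1 n (t : braid n) (x : sbraid1_gen n) : braid n :=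
  match x with Br1 b => pgen b | Tau1 => t end.

Definition first_idx n (n_gt1 : 1 < n) : 'I_n.-1 :=
  Ordinal (etrans (ltn_predRL 0 n) n_gt1).

Section Twist.
Variables (n : nat) (M : monoidType) (h : braid n -> M).
Hypothesis h_morph : monoid_morphism h.

Let h1 : h 1 = 1. Proof. exact: h_morph.1. Qed.
Let hM a b : h (a * b) = h a * h b. Proof. exact: h_morph.2. Qed.

Definition twist (b : braid n) (x : M) : M := h b * x * h b^-1.

Let hVK b : h b^-1 * h b = 1. Proof. by rewrite -hM mulVg h1. Qed.
Let hKV b : h b * h b^-1 = 1. Proof. by rewrite -hM mulgV h1. Qed.

Lemma twistM b x y : twist b (x * y) = twist b x * twist b y.
Proof.
by rewrite /twist !mulgA -(mulgA _ (h b^-1) (h b)) hVK mulg1.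
Qed.

Lemma twist_h b c : twist b (h c) = h (b * c * b^-1).
Proof. by rewrite /twist !hM. Qed.

Lemma twist_comp b c x : twist b (twist c x) = twist (b * c) x.
Proof. by rewrite /twist invgM !hM !mulgA. Qed.

Lemma twist1 x : twist 1 x = x.
Proof. by rewrite /twist invg1 h1 mul1g mulg1. Qed.

Lemma twist_commute b x : twist b x = x <-> h b * x = x * h b.
Proof.
rewrite /twist; split=> [E|->]; last by rewrite -mulgA hKV mulg1.
by rewrite -{2}E -mulgA hVK mulg1.
Qed.

Lemma twistE b x y : h b * x = y * h b -> twist b x = y.
Proof. by rewrite /twist => ->; rewrite -mulgA hKV mulg1. Qed.

Lemma twistP b x y : twist b x = y -> h b * x = y * h b.
Proof. by rewrite /twist => <-; rewrite -[in RHS]mulgA hVK mulg1. Qed.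

End Twist.

Section BraidFacts.
Variable n : nat.

Definition sg (k : nat) : braid n :=
  if insub k is Some i then sigma i else 1.

Lemma sgE (i : 'I_n.-1) : sg i = sigma i.
Proof. by rewrite /sg valK. Qed.

Lemma sg_comm i j : i.+1 < j -> sg i * sg j = sg j * sg i.
Proof.
move=> ij; rewrite /sg; case: insubP => [a _ Ea|_]; last by rewrite mul1g mulg1.
case: insubP => [b _ Eb|_]; last by rewrite mul1g mulg1.
rewrite /sigma -!pwordM; apply/pwordP/Cong_rel/Brel_comm.
by rewrite /far Ea Eb ij.
Qed.

Lemma sg_braid i :
  i.+1 < n.-1 -> sg i * sg i.+1 * sg i = sg i.+1 * sg i * sg i.+1.
Proof.
move=> lt_i; have lt_i' := ltnW lt_i.
have /= E1 := sgE (Ordinal lt_i); have /= E2 := sgE (Ordinal lt_i').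
rewrite E1 E2 /sigma -!pwordM.
by apply/pwordP/Cong_rel => /=; apply: Brel_braid.
Qed.

Lemma sg_slide : 2 < n.-1 ->
  sg 0%N * sg 1%N * sg 2 * sg 0%N * sg 1%N =
  sg 1%N * sg 2 * sg 0%N * sg 1%N * sg 2.
Proof.
move=> lt2; have lt1 := ltnW lt2.
rewrite -(mulgA _ (sg 2) (sg 0%N)) -(sg_comm (i := 0) (j := 2)) // !mulgA sg_braid //.
rewrite -(mulgA _ (sg 2) (sg 0%N)) -(sg_comm (i := 0) (j := 2)) // !mulgA.
rewrite -[in LHS](mulgA _ (sg 1%N) (sg 2)) -(mulgA _ (sg 1%N * sg 2)).
by rewrite sg_braid // !mulgA.
Qed.

Definition coxeter m := \prod_(0 <= i < m) sg i.

Lemma coxeterS m : coxeter m.+1 = coxeter m * sg m.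
Proof. by rewrite /coxeter big_nat_recr. Qed.

Lemma coxeter_comm m j : m < j -> coxeter m * sg j = sg j * coxeter m.
Proof.
elim: m => [|m IHm] lt_mj; first by rewrite /coxeter big_geq // mul1g mulg1.
by rewrite coxeterS -mulgA sg_comm // mulgA IHm ?mulgA // ltnW.
Qed.

Lemma coxeter_shift m i :
  i.+1 < m -> m <= n.-1 -> coxeter m * sg i = sg i.+1 * coxeter m.
Proof.
elim: m => // m IHm; rewrite ltnS leq_eqVlt => /predU1P[<- | lt_im] le_m.
  rewrite !coxeterS -2!mulgA [sg i * _]mulgA sg_braid //.
  by rewrite -!mulgA !(mulgA (coxeter i)) coxeter_comm // !mulgA.
by rewrite coxeterS -mulgA -sg_comm // mulgA IHm ?mulgA // ltnW.
Qed.

Definition cox : braid n := coxeter n.-1.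

Lemma cox_shift k i :
  i + k < n.-1 -> cox ^+ k * sg i = sg (i + k) * cox ^+ k.
Proof.
elim: k => [|k IHk] lt_ik; first by rewrite expg0 mul1g mulg1 addn0.
rewrite addnS in lt_ik *; rewrite expgS -!mulgA (IHk (ltnW lt_ik)).
by rewrite !mulgA /cox coxeter_shift.
Qed.

End BraidFacts.

Lemma sbraid_of_braid n :
  exists h : braid n -> sbraid n, defines_morphism (fun b => pgen (Br b)) h.
Proof.
apply: presented_lift => u v uv.
rewrite -[LHS](big_map (@Br n) xpredT) -[RHS](big_map (@Br n) xpredT).
rewrite -!pword_prod; apply/pwordP/Cong_rel; exact: SBrel_braid.
Qed.

Lemma sbraid1_of_braid n :
  exists h : braid n -> sbraid1 n, defines_morphism (fun b => pgen (Br1 b)) h.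
Proof.
apply: presented_lift => u v uv.
rewrite -[LHS](big_map (@Br1 n) xpredT) -[RHS](big_map (@Br1 n) xpredT).
rewrite -!pword_prod; apply/pwordP/Cong_rel; exact: SB1rel_braid.
Qed.

(* The conjugates tau_i := c^(i-1) tau_1 c^-(i-1), where c is the Coxeter     *)
(* element sigma_1 ... sigma_(n-1), satisfy the relations of sbraid.          *)
Section Iso1.
Variables (n : nat) (h : braid n -> sbraid1 n).
Hypothesis h_def : defines_morphism (fun b => pgen (Br1 b)) h.
Local Notation sg := (sg n).
Local Notation cox := (cox n).
Local Notation tau := (pgen Tau1 : sbraid1 n).
Local Notation tw := (twist h).

Let h_morph : monoid_morphism h. Proof. by case: h_def. Qed.
Let h1 : h 1 = 1. Proof. exact: h_morph.1. Qed.
Let hM a b : h (a * b) = h a * h b. Proof. exact: h_morph.2. Qed.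
Let hgen b : h (pgen b) = pgen (Br1 b). Proof. by case: h_def. Qed.
Let hs (i : 'I_n.-1) : pgen (Br1 (Sg i)) = h (sg i).
Proof. by rewrite sgE /sigma hgen. Qed.
Let hw u : h (pword u) = pword (map (@Br1 n) u).
Proof.
rewrite !pword_prod big_map.
elim: u => [|x u IHu]; rewrite ?big_nil ?h1 // !big_cons hM IHu hgen //.
Qed.

Lemma tau1_comm j : j != 1%N -> tw (sg j) tau = tau.
Proof.
move=> j_neq1; apply: twistE; rewrite // /sg.
case: insubP => [i _ Ei|_]; last by rewrite h1 mul1g mulg1.
rewrite /sigma hgen -!pwordM; apply/pwordP/Cong_sym/Cong_rel.
have [i_gt1|] := ltnP 1 i; first exact: SB1rel_tausigma.
move=> i_le1; apply: SB1rel_comm; move: i_le1 j_neq1; rewrite -Ei /=.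
by case: (nat_of_ord i) => [|[]].
Qed.

Definition tauc k := tw (cox ^+ k) tau.

Lemma tauc0 : tauc 0 = tau. Proof. by rewrite /tauc expg0 (twist1 h_morph). Qed.

Lemma tauc1 : 1 < n.-1 -> tw cox tau = tw (sg 0%N * sg 1%N) tau.
Proof.
move=> lt1; rewrite /cox /coxeter (big_cat_nat _ lt1) //=.
rewrite big_nat_recl // big_nat1 -[LHS](twist_comp h_morph); congr (tw _ _).
rewrite big_nat; elim/big_rec: _ => [|i x /andP[i_gt1 _] IHx].
  exact: (twist1 h_morph).
by rewrite -(twist_comp h_morph) IHx tau1_comm // gtn_eqF.
Qed.

Lemma taucD i d : tw (cox ^+ i) (tauc d) = tauc (i + d).
Proof. by rewrite /tauc (twist_comp h_morph) expgnDr. Qed.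

Lemma taucS k : k.+1 < n.-1 -> tauc k.+1 = tw (sg k * sg k.+1) (tauc k).
Proof.
move=> lt_k; rewrite -addn1 -taucD {1}/tauc expg1.
rewrite tauc1; last exact: leq_ltn_trans lt_k.
rewrite /tauc !(twist_comp h_morph); congr tw.
rewrite mulgA (cox_shift (i := 0)) ?add0n; last exact: ltnW.
by rewrite -mulgA (cox_shift (i := 1)) ?add1n ?addn1 // !mulgA.
Qed.

Lemma sg_tauc d : 1 < d < n.-1 -> tw (sg 0%N) (tauc d) = tauc d.
Proof.
case/andP; elim: d => // d IHd; rewrite ltnS leq_eqVlt => /predU1P[<- | d_gt1] ltd.
  have lt1 := ltnW ltd.
  rewrite !taucS // tauc0 !(twist_comp h_morph).
  rewrite (_ : _ * _ = sg 1%N * sg 2 * (sg 0%N * sg 1%N) * sg 2).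
    by rewrite -(twist_comp h_morph _ (sg 2)) tau1_comm.
  by rewrite !mulgA sg_slide.
rewrite taucS // (twist_comp h_morph).
rewrite mulgA (sg_comm n (i := 0)) // -mulgA (sg_comm n (i := 0)) 1?ltnW // mulgA.
by rewrite -(twist_comp h_morph _ (sg 0%N)) IHd // ltnW.
Qed.

Lemma tau_tauc d : 1 < d < n.-1 -> tau * tauc d = tauc d * tau.
Proof.
case/andP; elim: d => // d IHd; rewrite ltnS leq_eqVlt => /predU1P[<- | d_gt1] ltd.
  have lt1 := ltnW ltd; have lt0 := ltnW lt1.
  rewrite !taucS // tauc0 (twist_comp h_morph).
  pose w : seq (braid_gen n) := [:: Sg (Ordinal lt1); Sg (Ordinal lt0);
    Sg (Ordinal ltd); Sg (Ordinal lt1)].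
  pose W : braid n := pword w.
  have E : sg 1%N * sg 2 * (sg 0%N * sg 1%N) = W.
    rewrite -!mulgA [sg 2 * _]mulgA -(sg_comm n (i := 0)) // -!mulgA.
    have /= E0 := sgE (Ordinal lt0); have /= E1 := sgE (Ordinal lt1).
    have /= E2 := sgE (Ordinal ltd).
    by rewrite E0 E1 E2 /sigma -!pwordM.
  have wV : pword (word_inv w) = W^-1 :> braid n.
    by apply/esym/mulg1_eq; apply: word_mulV.
  have := SB1rel_tautau (i := Ordinal lt0) (j := Ordinal lt1)
    (k := Ordinal ltd) erefl erefl erefl.
  move=> /Cong_rel/pwordP R; rewrite -/w !pwordM -!hw wV -/W -/tau !mulgA in R.
  rewrite E /twist.
  have hKV : h W * h W^-1 = 1 by rewrite -hM mulgV h1.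
  move: R hKV; set a := h W; set b := h W^-1 => R hKV.
  have: a * (tau * b * tau * a) * b = a * (b * tau * a * tau) * b by rewrite R.
  rewrite -!mulgA !(mulgA a b) hKV !mulg1 !mul1g !mulgA.
  by move=> ->.
rewrite taucS // -[tau](_ : tw (sg d * sg d.+1) tau = tau).
  by rewrite -!(twistM h_morph) IHd // ltnW.
by rewrite -(twist_comp h_morph) !tau1_comm // gtn_eqF // ltnW.
Qed.

Let assign_tau (x : sbraid_gen n) : sbraid1 n :=
  match x with Br b => pgen (Br1 b) | Tau i => tauc i end.

Let tauc_comm (i d : nat) : 1 < d -> i + d < n.-1 ->
  tauc i * tauc (i + d) = tauc (i + d) * tauc i.
Proof.
move=> d_gt1 lt_id; rewrite -{1 4}[i]addn0 -!taucD -!(twistM h_morph) tauc0.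
by rewrite tau_tauc // d_gt1 (leq_ltn_trans _ lt_id) ?leq_addl.
Qed.

Let tauc_sg_shift (i j k : nat) : i + k < n.-1 -> tw (sg j) (tauc i) = tauc i ->
  j + k < n.-1 -> tw (sg (j + k)) (tauc (i + k)) = tauc (i + k).
Proof.
move=> lt_ik E lt_jk; rewrite [i + k]addnC -taucD (twist_comp h_morph).
by rewrite -cox_shift // -(twist_comp h_morph) E.
Qed.

Let tauc_sg (i j : 'I_n.-1) : j.+1 != i -> j != i.+1 :> nat ->
  h (sg j) * tauc i = tauc i * h (sg j).
Proof.
move=> neq1 neq2; apply: (twistP h_morph).
have [le_ij|lt_ji] := leqP i j.
  have := @tauc_sg_shift 0 (j - i) i; rewrite add0n subnK // => -> //.
  by rewrite tauc0 tau1_comm // -(eqn_add2r i) subnK // add1n.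
have := @tauc_sg_shift (i - j) 0 j; rewrite add0n (subnK (ltnW lt_ji)) => -> //.
rewrite sg_tauc // ltn_subRL addn1 ltn_neqAle neq1 lt_ji /=.
by rewrite (leq_ltn_trans (leq_subr _ _)).
Qed.

Let tauc_left i : i.+1 < n.-1 ->
  tw (sg i.+1 * sg i * sg i * sg i.+1) (tauc i) = tauc i.
Proof.
move=> lt_i; have lt1 : 1 < n.-1 by apply: leq_ltn_trans lt_i.
have E : tw (sg 1%N * sg 0%N * sg 0%N * sg 1%N) tau = tau.
  apply: (twistE h_morph); have lt0 := ltnW lt1; symmetry.
  have /= E0 := sgE (Ordinal lt0); have /= E1 := sgE (Ordinal lt1).
  rewrite E0 E1 /sigma -!pwordM hw -!pwordM; apply/pwordP/Cong_rel.
  exact: SB1rel_left.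
rewrite /tauc -[in RHS]E !(twist_comp h_morph); congr (tw _ _).
have E0 := @cox_shift n i 0; have E1 := @cox_shift n i 1.
rewrite add0n in E0; rewrite add1n in E1.
rewrite !mulgA E1 // -!(mulgA (sg i.+1)) -!mulgA; congr (_ * _).
rewrite (mulgA (cox ^+ i)) E0 1?ltnW // -!mulgA; congr (_ * _).
by rewrite (mulgA (cox ^+ i)) E0 1?ltnW // -!mulgA E1.
Qed.

Lemma sbraid_sbraid1 : exists f : sbraid n -> sbraid1 n,
  defines_morphism assign_tau f.
Proof.
apply: presented_lift => u v.
have assignE w : \prod_(x <- map (@Br n) w) assign_tau x = h (pword w).
  by rewrite big_map hw pword_prod big_map.
case=> [{}u {}v uv|i j ij|i j ij|i|i j ji|i j ji].
- by rewrite !assignE; congr h; apply/pwordP/Cong_rel.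
- rewrite !big_cons !big_nil !mulg1 /=.
  have [lt_ij|lt_ji] := ltnP i j.
    have := @tauc_comm i (j - i); rewrite subnKC; last exact: ltnW.
    by apply=> //; move: ij; rewrite /far; lia.
  have := @tauc_comm j (i - j); rewrite subnKC // => E.
  by symmetry; apply: E => //; move: ij; rewrite /far; lia.
- rewrite !big_cons !big_nil !mulg1 /= hs tauc_sg //.
    by move: ij; rewrite /far; lia.
  by move: ij; rewrite /far; lia.
- rewrite !big_cons !big_nil !mulg1 /= hs tauc_sg //; lia.
- rewrite !big_cons !big_nil !mulg1 /= !hs ji.
  have lt_i : i.+1 < n.-1 by rewrite -ji.
  rewrite [RHS]mulgA -!hM; symmetry; apply: (twistP h_morph).
  by rewrite taucS // (twist_comp h_morph) mulgA tauc_left.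
rewrite !big_cons !big_nil !mulg1 /= !hs ji.
have lt_i : i.+1 < n.-1 by rewrite -ji.
by rewrite taucS // mulgA -hM; apply: (twistP h_morph).
Qed.

End Iso1.

Section Iso.
Variables (n : nat) (n_gt1 : 1 < n) (h : braid n -> sbraid n).
Hypothesis h_def : defines_morphism (fun b => pgen (Br b)) h.
Local Notation sg := (sg n).
Local Notation tw := (twist h).

Let h_morph : monoid_morphism h. Proof. by case: h_def. Qed.
Let h1 : h 1 = 1. Proof. exact: h_morph.1. Qed.
Let hM a b : h (a * b) = h a * h b. Proof. exact: h_morph.2. Qed.
Let hgen b : h (pgen b) = pgen (Br b). Proof. by case: h_def. Qed.
Let hs (i : 'I_n.-1) : pgen (Br (Sg i)) = h (sg i).
Proof. by rewrite sgE /sigma hgen. Qed.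

Definition sbraid1_emb (x : sbraid1_gen n) : sbraid n :=
  match x with Br1 b => pgen (Br b) | Tau1 => pgen (Tau (first_idx n_gt1)) end.

Let tau (i : 'I_n.-1) : sbraid n := pgen (Tau i).

Lemma tau_right (i j : 'I_n.-1) : j = i.+1 :> nat ->
  tw (sg i * sg j) (tau i) = tau j.
Proof.
move=> ji; apply: (twistE h_morph); rewrite hM -!hs -!pwordM.
by apply/pwordP/Cong_rel/SBrel_right.
Qed.

Lemma tau_left (i j : 'I_n.-1) : j = i.+1 :> nat ->
  tw (sg j * sg i) (tau j) = tau i.
Proof.
move=> ji; apply: (twistE h_morph); rewrite hM -!hs -!pwordM.
by apply/pwordP/Cong_sym/Cong_rel/SBrel_left.
Qed.

Let hw u : h (pword u) = pword (map (@Br n) u).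
Proof.
rewrite !pword_prod big_map.
by elim: u => [|x u IHu]; rewrite ?big_nil ?h1 // !big_cons hM IHu hgen.
Qed.

Lemma sbraid1_sbraid : exists f : sbraid1 n -> sbraid n,
  defines_morphism sbraid1_emb f.
Proof.
apply: presented_lift => u v.
have embE w : \prod_(x <- map (@Br1 n) w) sbraid1_emb x = h (pword w).
  by rewrite big_map hw pword_prod big_map.
have firstE (i : 'I_n.-1) : i = 0%N :> nat -> first_idx n_gt1 = i.
  by move=> i0; apply: val_inj; rewrite /= i0.
case=> [{}u {}v uv|i j k w i0 j1 k2|j j_gt1|i i0|i j i0 j1].
- by rewrite !embE; congr h; apply/pwordP/Cong_rel.
- pose W : braid n := pword w.
  have WV : pword (word_inv w) = W^-1 :> braid n.
    by apply/esym/mulg1_eq; apply: word_mulV.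
  have WE : W = sg j * sg i * (sg k * sg j) by rewrite !sgE /sigma -!pwordM.
  have tauE : h W^-1 * tau i * h W = tau k.
    have <- : tw W (tau k) = tau i.
      rewrite WE -(twist_comp h_morph) tau_left ?tau_left //.
        by rewrite j1 i0.
      by rewrite k2 j1.
    have hVK : h W^-1 * h W = 1 by rewrite -hM mulVg h1.
    by rewrite /twist -!mulgA hVK mulg1 mulgA hVK mul1g.
  rewrite !big_cat !embE big_seq1 /= (firstE i) // -/(tau i) WV -/W.
  rewrite !mulgA tauE -2!mulgA (mulgA (h _)) tauE /tau -!pwordM.
  by apply/pwordP/Cong_rel/SBrel_tautau; rewrite /far i0 k2.
- rewrite !big_cons !big_nil !mulg1 /= -!pwordM; apply/pwordP/Cong_rel.
  by apply: SBrel_tausigma; rewrite /far /= j_gt1.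
- rewrite !big_cons !big_nil !mulg1 /= (firstE i) // -!pwordM.
  exact/pwordP/Cong_rel/SBrel_comm.
rewrite !big_cons !big_nil !mulg1 /= (firstE i) // -/(tau i) !hs.
have ji : j = i.+1 :> nat by rewrite i0.
have X : tw (sg j * sg i * (sg i * sg j)) (tau i) = tau i.
  by rewrite -(twist_comp h_morph) (tau_right ji) (tau_left ji).
by have := twistP h_morph X; rewrite !hM !mulgA => ->.
Qed.

End Iso.

(* [sbraid1 n] presents the same monoid as [sbraid n], the singular generator *)
(* Tau1 being the singular crossing tau_1.                                    *)
Lemma sbraid1_iso n (n_gt1 : 1 < n) : exists f : sbraid1 n -> sbraid n,
  defines_morphism (sbraid1_emb n_gt1) f /\ bijective f.
Proof.
have [h h_def] := sbraid_of_braid n; have [h' h'_def] := sbraid1_of_braid n.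
have [f f_def] := sbraid1_sbraid n_gt1 h_def.
have [g g_def] := sbraid_sbraid1 h'_def.
have [f_morph fgen _] := f_def; have [g_morph ggen _] := g_def.
exists f; split=> //; exists g.
  apply: presented_morphism_eq => [|//|x].
    by split=> [|x y]; rewrite ?f_morph.1 ?g_morph.1 // f_morph.2 g_morph.2.
  rewrite fgen; case: x => [b|] /=; first by rewrite ggen.
  by rewrite ggen tauc0.
have h_morph : monoid_morphism h by case: h_def.
have h'_morph : monoid_morphism h' by case: h'_def.
have fh' : f \o h' =1 h.
  apply: presented_morphism_eq => [|//|b].
    split=> [|x y]; rewrite /= ?h'_morph.1 ?f_morph.1 //.
    by rewrite h'_morph.2 f_morph.2.
  by case: h_def => _ -> _; case: h'_def => _ /= -> _; rewrite fgen.
have ftauc k (lt_k : k < n.-1) : f (tauc h' k) = pgen (Tau (Ordinal lt_k)).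
  elim: k lt_k => [|k IHk] lt_k.
    rewrite (tauc0 h'_def) fgen /=; congr (pgen (Tau _)); exact: val_inj.
  rewrite (taucS h'_def) // /twist 2!f_morph.2 (IHk (ltnW lt_k)).
  have fE b : f (h' b) = h b by apply: fh'.
  rewrite !fE.
  exact: (tau_right h_def (i := Ordinal (ltnW lt_k)) (j := Ordinal lt_k)).
apply: presented_morphism_eq => [|//|x].
  by split=> [|x y]; rewrite ?g_morph.1 ?f_morph.1 // g_morph.2 f_morph.2.
rewrite ggen; case: x => [b|i] /=; first by rewrite fgen.
by rewrite ftauc; congr (pgen (Tau _)); apply: val_inj.
Qed.

(* Main.v *)
(* Conjugation commutes with powers, so every relation of SB_n survives       *)
(* tau_i |-> sigma_i^k.  The resulting map is the identity on braid words,    *)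
(* hence surjective; it sends tau_1 to the image of a word without singular   *)
(* crossings, while the relations of SB_n preserve the presence of a singular *)
(* crossing, so it is not injective.                                          *)

Require Import Defs.
From mathcomp Require Import all_boot ssralg ssrint.

Set Implicit Arguments.
Unset Strict Implicit.
Unset Printing Implicit Defensive.

Local Open Scope group_scope.

(** All parts are instances of sending each tau_i to sigma_i^k, with k = 2 or k = 2p. Each relation
    of SB_n involving tau says that an element carries one singular generator to another or commutes
    with it; in B_n the matching identity holds for the sigma_i, hence for their k-th powers
    ([expgz_intertwine]). The kernel argument ignores the value chosen for tau_1
    ([sbraid_to_braid_surj_not_inj]), and the one-generator version is pulled back along
    [sbraid1_iso]. *)

Lemma expgz_intertwine (G : groupType) (a x y : G) (k : int) :
  a * x = y * a -> a * expgz x k = expgz y k * a.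
Proof.
have natP m (b u v : G) : b * u = v * b -> b * u ^+ m = v ^+ m * b.
  move=> E; elim: m => [|m IHm]; first by rewrite !expg0 mulg1 mul1g.
  by rewrite !expgS mulgA E -mulgA IHm mulgA.
move=> E; case: k => m /=; first exact: natP.
have := natP m.+1 _ _ _ E; set u := x ^+ _; set v := y ^+ _ => Em.
(* A negative power reduces to the positive one after multiplying by [v] on the left. *)
by apply: (mulgI v); rewrite mulgA -Em !mulgA mulgV mul1g mulgK.
Qed.

Lemma sigma_far n (i j : 'I_n.-1) :
  far i j -> sigma i * sigma j = sigma j * sigma i.
Proof.
by move=> ij; rewrite /sigma -!pwordM; apply/pwordP/Cong_rel/Brel_comm.
Qed.

Lemma sigma_braid n (i j : 'I_n.-1) : j = i.+1 :> nat ->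
  sigma i * sigma j * sigma i = sigma j * sigma i * sigma j.
Proof.
by move=> ji; rewrite /sigma -!pwordM; apply/pwordP/Cong_rel/Brel_braid.
Qed.

Lemma sbraid_power_morphism n (k : int) : exists f : sbraid n -> braid n,
  defines_morphism (assign (fun i => expgz (sigma i) k)) f.
Proof.
apply: presented_lift => u v.
have assignE w : \prod_(x <- map (@Br n) w)
    assign (fun i => expgz (sigma i) k) x = pword w.
  by rewrite big_map pword_prod.
case=> [{}u {}v uv|i j ij|i j ij|i|i j ji|i j ji];
  rewrite ?assignE; first exact/pwordP/Cong_rel;
  rewrite !big_cons !big_nil !mulg1 /=.
(* Powers are passed to one factor at a time: first that of sigma_j, then that of sigma_i. *)
- apply: expgz_intertwine; apply/esym/expgz_intertwine; exact/esym/sigma_far.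
- apply/esym/expgz_intertwine; exact/esym/sigma_far.
- exact/esym/expgz_intertwine.
(* By the braid relation, [sigma j * sigma i] conjugates [sigma j] to [sigma i]. *)
- rewrite [RHS]mulgA; apply/esym/expgz_intertwine.
  by rewrite mulgA (sigma_braid ji).
- rewrite mulgA; apply: expgz_intertwine.
  by rewrite mulgA (sigma_braid ji).
Qed.

Definition is_singular n (x : sbraid_gen n) : bool :=
  if x is Tau _ then true else false.

Lemma has_singular_Br n (w : seq (braid_gen n)) :
  has (@is_singular n) (map (@Br n) w) = false.
Proof. by elim: w. Qed.

(** Each defining relation has a tau on both sides or on neither, and this property is stable under
    concatenation. *)
Lemma congruence_has_singular n (u v : seq (sbraid_gen n)) :
  congruence (@sbraid_rel n) u v ->
  has (@is_singular n) u = has (@is_singular n) v.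
Proof.
elim=> {u v} [u v []|//|//|v u w _ -> //|u u' v v' _ Eu _ Ev] //.
  by move=> {}u {}v _; rewrite !has_singular_Br.
by rewrite !has_cat Eu Ev.
Qed.

(** Such a map is the identity on braid words, so it is onto, and tau_1 shares its image with some
    braid word, from which it differs in SB_n. *)
Lemma sbraid_to_braid_surj_not_inj n (t : 'I_n.-1 -> braid n)
    (f : sbraid n -> braid n) :
  1 < n -> defines_morphism (assign t) f ->
  (forall b, exists x, f x = b) /\ ~ injective f.
Proof.
move=> n_gt1 [[f1 fM] fgen _].
have fBr w : f (pword (map (@Br n) w)) = pword w.
  elim: w => [|x w IHw]; first exact: f1.
  by rewrite -[x :: w]cat1s map_cat !pwordM fM IHw; congr (_ * _); apply: fgen.
split=> [b|f_inj].
  by have [w ->] := pword_surj b; exists (pword (map (@Br n) w)).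
pose tau : sbraid n := pgen (Tau (first_idx n_gt1)).
have [w fw] := pword_surj (f tau).
have /pwordP/congruence_has_singular : tau = pword (map (@Br n) w).
  by apply: f_inj; rewrite fw fBr.
by rewrite has_singular_Br.
Qed.

Lemma sbraid_power_epi n (n_gt1 : 1 < n) (k : int) :
  exists f : sbraid n -> braid n,
    [/\ defines_morphism (assign (fun i => expgz (sigma i) k)) f,
        forall b, exists x, f x = b &
        ~ injective f].
Proof.
have [f f_def] := sbraid_power_morphism n k.
by have [] := sbraid_to_braid_surj_not_inj n_gt1 f_def; exists f.
Qed.

Lemma sbraid1_power_epi n (n_gt1 : 1 < n) (k : int) :
  exists f : sbraid1 n -> braid n,
    [/\ defines_morphism (assign1 (expgz (sigma (first_idx n_gt1)) k)) f,
        forall b, exists x, f x = b &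
        ~ injective f].
Proof.
have [f [[[f1 fM] fgen _] f_surj f_ninj]] := sbraid_power_epi n_gt1 k.
have [e [[[e1 eM] egen _] [e' eK e'K]]] := sbraid1_iso n_gt1.
have fe_morph : monoid_morphism (f \o e).
  by split=> [|x y] /=; rewrite ?e1 // eM fM.
have fe_gen x :
    f (e (pgen x)) = assign1 (expgz (sigma (first_idx n_gt1)) k) x.
  by rewrite egen; case: x => [b|] /=; rewrite fgen.
exists (f \o e); split=> [|b|fe_inj].
- split=> // g g_morph ggen; apply: presented_morphism_eq => // x.
  by rewrite ggen /= fe_gen.
- by have [x <-] := f_surj b; exists (e' x); rewrite /= e'K.
apply: f_ninj => x y fxy; rewrite -(e'K x) -(e'K y); congr e.
by apply: fe_inj; rewrite /= !e'K.
Qed.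

Theorem theorem7p6 (n : nat) (n_gt1 : (1 < n)%N) :
  [/\ exists sPhi : sbraid n -> braid n,
        [/\ defines_morphism (assign (fun i => sigma i ^+ 2)) sPhi,
            forall b : braid n, exists x, sPhi x = b &
            ~ injective sPhi],
      exists sPhi1 : sbraid1 n -> braid n,
        [/\ defines_morphism (assign1 (sigma (first_idx n_gt1) ^+ 2)) sPhi1,
            forall b : braid n, exists x, sPhi1 x = b &
            ~ injective sPhi1] &
      forall p : int,
        (exists sPhi_p : sbraid n -> braid n,
          [/\ defines_morphism
                (assign (fun i => expgz (sigma i) (2 * p)%R)) sPhi_p,
              forall b : braid n, exists x, sPhi_p x = b &
              ~ injective sPhi_p]) /\
        (exists sPhi1_p : sbraid1 n -> braid n,
          [/\ defines_morphism
                (assign1 (expgz (sigma (first_idx n_gt1)) (2 * p)%R)) sPhi1_p,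
              forall b : braid n, exists x, sPhi1_p x = b &
              ~ injective sPhi1_p])].
Proof.
split=> [||p].
(* At the integer 2, [expgz] computes to [^+ 2]. *)
- exact: (sbraid_power_epi n_gt1 2).
- exact: (sbraid1_power_epi n_gt1 2).
split; [exact: sbraid_power_epi | exact: sbraid1_power_epi].
Qed.
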